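(* Let $q\in\mathbb{C}$, $q\neq 0$. Let $\lambda=(\lambda_1,\lambda_2)\in\mathbb{C}^2$ with $\lambda_1\lambda_2\neq 0$ and let $\alpha\in\mathbb{C}$. Then $\Omega'(\lambda,\alpha)$ is the unique nonzero proper $\mathcal{B}(q)$-submodule of $\Omega(\lambda,\alpha)$. In particular, $\Omega'(\lambda,\alpha)$ is a simple $\mathcal{B}(q)$-module.
   Context: Everything is over $\mathbb{C}$. The Block algebra $\mathcal{B}(q)$ is the Lie algebra with basis $\{L_{\mathbf{m}} : \mathbf{m}=(m_1,m_2)\in\mathbb{Z}^2\}$ and brackets $$[L_{\mathbf m},L_{\mathbf n}]=(n_1(m_2+q)-m_1(n_2+q))L_{\mathbf m+\mathbf n},\qquad \mathbf m,\mathbf n\in\mathbb{Z}^2.$$ For $\lambda=(\lambda_1,\lambda_2)\in\mathbb{C}^2$ with $\lambda_1\lambda_2\ne0$ and $\alpha\in\mathbb{C}$, $\Omega(\lambda,\alpha)$ is the vector space $\mathbb{C}[\partial_1,\partial_2]$ of polynomials in two commuting variables $\partial_1,\partial_2$, with the $\mathcal{B}(q)$-module structure $$L_{\mathbf m}\cdot f(\partial_1,\partial_2)=\lambda_1^{m_1}\lambda_2^{m_2}\bigl(\partial_1(q+m_2)-m_1(q\alpha+\partial_2)\bigr)f(\partial_1-m_1,\partial_2-m_2)$$ for $\mathbf m=(m_1,m_2)\in\mathbb{Z}^2$ and $f\in\mathbb{C}[\partial_1,\partial_2]$. $\Omega'(\lambda,\alpha)=\partial_1\,\mathbb{C}[\partial_1,\partial_2]+(q\alpha+\partial_2)\,\mathbb{C}[\partial_1,\partial_2]$,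 which is a $\mathcal{B}(q)$-submodule of $\Omega(\lambda,\alpha)$. *)

(* Defs.v *)
From HB Require Import structures.
From mathcomp Require Import all_boot all_order all_algebra.
From mathcomp Require Import finmap.
From mathcomp Require Import boolp classical_sets reals complex.
From mathcomp.multinomials Require Import monalg.
From mathcomp.multinomials Require mpoly.
From mathcomp Require Import ring.

Set Implicit Arguments.
Unset Strict Implicit.
Unset Printing Implicit Defensive.

Import Order.TTheory GRing.Theory Num.Theory.
Local Open Scope classical_set_scope.
Local Open Scope ring_scope.

Record lieAlgebra (K : fieldType) := LieAlgebra {
  lie_sort :> lmodType K;
  lie_br : lie_sort -> lie_sort -> lie_sort;
  lie_br_linearl : forall y, linear (lie_br^~ y);
  lie_br_linearr : forall x, linear (lie_br x);
  lie_brxx : forall x, lie_br x x = 0;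
  lie_jacobi : forall x y z,
    lie_br x (lie_br y z) + lie_br y (lie_br z x) + lie_br z (lie_br x y) = 0
}.

Record lieModule (K : fieldType) (g : lieAlgebra K) := LieModule {
  lmod_sort :> lmodType K;
  lie_act : g -> lmod_sort -> lmod_sort;
  lie_act_linearl : forall v, linear (lie_act^~ v);
  lie_act_linearr : forall x, linear (lie_act x);
  lie_act_br : forall x y v,
    lie_act (lie_br x y) v = lie_act x (lie_act y v) - lie_act y (lie_act x v)
}.

(* Submodules are Prop-valued sets, hence not assumed decidable. *)
Record lieSubmodule (K : fieldType) (g : lieAlgebra K) (M : lieModule g) :=
  LieSubmodule {
  lsub_set :> set M;
  lsub0 : lsub_set 0;
  lsub_linear : forall (a : K) u v,
    lsub_set u -> lsub_set v -> lsub_set (a *: u + v);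
  lsub_act : forall (x : g) v, lsub_set v -> lsub_set (lie_act x v)
}.

Definition nonzero_proper (K : fieldType) (g : lieAlgebra K) (M : lieModule g)
    (N : lieSubmodule M) : Prop :=
  lsub_set N <> [set 0] /\ lsub_set N <> [set: M].

Definition simple_lieModule (K : fieldType) (g : lieAlgebra K)
    (M : lieModule g) : Prop :=
  [set: M] <> [set 0] /\
  forall N : lieSubmodule M, lsub_set N = [set 0] \/ lsub_set N = [set: M].

(* A Lie submodule N of M, viewed as a Lie module in its own right on the
   subtype of the elements of M that belong to N. *)
Section Restriction.
Context (K : fieldType) (g : lieAlgebra K) (M : lieModule g).
Variable N : lieSubmodule M.

Definition lsub_pred : {pred M} := fun v => `[< lsub_set N v >].

Fact lsub_pred_closed : submod_closed lsub_pred.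
Proof.
split; first exact/asboolP/lsub0.
by move=> a u v /asboolP Nu /asboolP Nv; apply/asboolP/lsub_linear.
Qed.

HB.instance Definition _ :=
  GRing.isSubmodClosed.Build K M lsub_pred lsub_pred_closed.

Record lsub_sort := LsubElt { lsub_val : M; _ : lsub_val \in lsub_pred }.

HB.instance Definition _ := [isSub for lsub_val].
HB.instance Definition _ := [Choice of lsub_sort by <:].
HB.instance Definition _ := [SubChoice_isSubLmodule of lsub_sort by <:].

Fact lsub_act_subproof (x : g) (v : lsub_sort) :
  lie_act x (lsub_val v) \in lsub_pred.
Proof. by apply/asboolP/lsub_act; case: v => v /= /asboolP. Qed.

Definition lsub_restr (x : g) (v : lsub_sort) : lsub_sort :=
  LsubElt (lsub_act_subproof x v).

Fact lsub_restr_linearl v : linear (lsub_restr^~ v).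
Proof. by move=> a x y; apply: val_inj; rewrite /= lie_act_linearl. Qed.

Fact lsub_restr_linearr x : linear (lsub_restr x).
Proof. by move=> a u v; apply: val_inj; rewrite /= lie_act_linearr. Qed.

Fact lsub_restr_br x y v :
  lsub_restr (lie_br x y) v =
  lsub_restr x (lsub_restr y v) - lsub_restr y (lsub_restr x v).
Proof. by apply: val_inj; rewrite /= lie_act_br. Qed.

Definition submodule_lieModule : lieModule g :=
  LieModule lsub_restr_linearl lsub_restr_linearr lsub_restr_br.

End Restriction.

(* {malg K[I]} is the K-vector space with basis the << i >>, i : I, and
   malg_ext F is the linear map sending << i >> to F i (see malg_extU). *)
Section LinearExtension.
Context (K : fieldType) (I : choiceType) (V : lmodType K).
Implicit Types (F : I -> V) (x : {malg K[I]}).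

Definition malg_ext F x : V := \sum_(i <- msupp x) x@_i *: F i.

Lemma malg_extEw F x (d : {fset I}) : (msupp x `<=` d)%fset ->
  malg_ext F x = \sum_(i <- d) x@_i *: F i.
Proof.
move=> le; rewrite /malg_ext; apply: big_fset_incl => // i _ /mcoeff_outdom ->.
by rewrite scale0r.
Qed.

Lemma malg_ext_linear F : linear (malg_ext F).
Proof.
move=> a x y; pose d := (msupp (a *: x + y) `|` (msupp x `|` msupp y))%fset.
rewrite (@malg_extEw F (a *: x + y) d) ?fsubsetUl //.
rewrite (@malg_extEw F x d) ?(@malg_extEw F y d).
- rewrite scaler_sumr -big_split /=; apply: eq_bigr => i _.
  by rewrite mcoeffD mcoeffZ scalerDl scalerA.
- by apply/fsubsetP => i iy; rewrite !inE iy !orbT.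
- by apply/fsubsetP => i ix; rewrite !inE ix !orbT.
Qed.

Lemma malg_extU F i : malg_ext F << i >> = F i.
Proof.
rewrite (@malg_extEw _ _ [fset i]%fset) ?msuppU_le //.
by rewrite big_seq_fset1 mcoeffUU scale1r.
Qed.

Lemma malg_ext_scale F (a : K) x :
  malg_ext (fun i => a *: F i) x = a *: malg_ext F x.
Proof.
rewrite scaler_sumr; apply: eq_bigr => i _.
by rewrite !scalerA mulrC.
Qed.

Lemma malg_ext_add F G x :
  malg_ext (fun i => F i + G i) x = malg_ext F x + malg_ext G x.
Proof. by rewrite -big_split; apply: eq_bigr => i _; rewrite scalerDr. Qed.

Lemma malg_ext_eq F G : F =1 G -> malg_ext F =1 malg_ext G.
Proof. by move=> FG x; apply: eq_bigr => i _; rewrite FG. Qed.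

Lemma malg_extK (f : {malg K[I]} -> V) :
  linear f -> f =1 malg_ext (fun i => f << i >>).
Proof.
move=> lf; pose L := GRing.isLinear.Build K {malg K[I]} V _ f lf.
pose h : {linear {malg K[I]} -> V} := HB.pack f L.
move=> x; rewrite -[f]/(h : _ -> _) {1}(monalgE x) linear_sum.
apply: eq_bigr => i _; rewrite -linearZ; congr (h _).
by apply/malgP => k; rewrite mcoeffZ !mcoeffU mulrnAr mulr1.
Qed.

Lemma eq_malg_linear (f h : {malg K[I]} -> V) :
  linear f -> linear h -> (forall i, f << i >> = h << i >>) -> f =1 h.
Proof.
by move=> lf lh fh x; rewrite malg_extK // [RHS]malg_extK //; apply: malg_ext_eq.
Qed.

End LinearExtension.

Section LmoduleFacts.
Context (K : numFieldType) (U V : lmodType K).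

Lemma eq_opp_eq0 (v : V) : v = - v -> v = 0.
Proof.
move=> /eqP; rewrite -addr_eq0 -mulr2n -scaler_nat.
by rewrite scaler_eq0 pnatr_eq0 => /eqP.
Qed.

Lemma linear_predZ (f : U -> V) : linear f -> scalable f.
Proof.
move=> lf a u; have f0 : f 0 = 0.
  by have := lf (-1) 0 0; rewrite scaler0 addr0 scaleN1r addNr.
by have := lf a u 0; rewrite !addr0 f0 addr0.
Qed.

Lemma linear_predD (f g : U -> V) :
  linear f -> linear g -> linear (fun u => f u + g u).
Proof. by move=> lf lg a u v; rewrite lf lg scalerDr addrACA. Qed.

Lemma linear_predN (f : U -> V) : linear f -> linear (fun u => - f u).
Proof. by move=> lf a u v; rewrite lf opprD scalerN. Qed.

End LmoduleFacts.

Section BasisBracket.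
Context (K : numFieldType) (I : zmodType) (c : I -> I -> K).
Local Notation V := {malg K[I]}.
Variable B : V -> V -> V.
Hypothesis Bl : forall y, linear (B^~ y).
Hypothesis Br : forall x, linear (B x).
Hypothesis BU : forall m n, B << m >> << n >> = c m n *: << (m + n)%R >>.
Implicit Types x y z u v w : V.

Lemma basis_brxx : (forall m n, c n m = - c m n) -> forall x, B x x = 0.
Proof.
move=> cN x; suff BN y : B x y = - B y x by exact: eq_opp_eq0 (BN x).
apply: (@eq_malg_linear K I V (B^~ y) (fun x => - B y x)).
- exact: Bl.
- exact/linear_predN/Br.
move=> m; apply: (@eq_malg_linear K I V (B << m >>) (fun y => - B y << m >>)).
- exact: Br.
- exact/linear_predN/Bl.
by move=> n; rewrite !BU cN (addrC n) scaleNr.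
Qed.

Lemma basis_jacobi :
  (forall m n p, c n p * c m (n + p) + c p m * c n (p + m)
                 + c m n * c p (m + n) = 0) ->
  forall x y z, B x (B y z) + B y (B z x) + B z (B x y) = 0.
Proof.
move=> cJ x y z.
have BZ w a u : B w (a *: u) = a *: B w u by exact: linear_predZ (Br w) a u.
pose J x y z := B x (B y z) + B y (B z x) + B z (B x y).
have Jrot u v w : J u v w = J v w u by rewrite /J -addrA addrC.
have Jlin v w : linear (fun u => J u v w).
  apply: linear_predD; first apply: linear_predD.
  - exact: Bl.
  - by move=> a u u'; rewrite !Br.
  - by move=> a u u'; rewrite Bl Br.
have lin0 : linear (fun _ : V => 0 : V).
  by move=> a u v; rewrite scaler0 addr0.
rewrite -/(J x y z).
apply: (eq_malg_linear (Jlin y z) lin0) => m; rewrite Jrot.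
apply: (eq_malg_linear (Jlin z << m >>) lin0) => n; rewrite Jrot.
apply: (eq_malg_linear (Jlin << m >> << n >>) lin0) => p.
rewrite /J !(BU, BZ) !scalerA.
have -> : n + (p + m) = m + (n + p) by rewrite addrA addrC.
have -> : p + (m + n) = m + (n + p) by rewrite addrCA (addrC p).
rewrite -!scalerDl cJ.
by rewrite scale0r.
Qed.

End BasisBracket.

(* The basis vector L_m of the Block algebra is << m >>, and block_br is the
   bilinear extension of block_brE. *)
Section Block.
Context (K : numFieldType) (q : K).
Local Notation Z2 := (int * int)%type.
Implicit Types (m n p : Z2) (x y z : {malg K[Z2]}).

Definition block_coef m n : K :=
  n.1%:~R * (m.2%:~R + q) - m.1%:~R * (n.2%:~R + q).

Definition block_br x y : {malg K[Z2]} :=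
  malg_ext (fun m => malg_ext (fun n => block_coef m n *: << (m + n)%R >>) y) x.

Lemma block_brE m n :
  block_br << m >> << n >> = block_coef m n *: << (m + n)%R >>.
Proof. by rewrite /block_br !malg_extU. Qed.

Fact block_br_linearl y : linear (block_br^~ y).
Proof. exact: malg_ext_linear. Qed.

Fact block_br_linearr x : linear (block_br x).
Proof.
move=> a y z; rewrite /block_br -malg_ext_scale -malg_ext_add.
by apply: malg_ext_eq => m; rewrite malg_ext_linear.
Qed.

Fact block_brxx x : block_br x x = 0.
Proof.
apply: (basis_brxx block_br_linearl block_br_linearr block_brE) => m n.
by rewrite /block_coef; ring.
Qed.

Fact block_jacobi x y z :
  block_br x (block_br y z) + block_br y (block_br z x)
  + block_br z (block_br x y) = 0.
Proof.
apply: (basis_jacobi block_br_linearl block_br_linearr block_brE) => m n p.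
by rewrite /block_coef /= !intrD; ring.
Qed.

Definition block : lieAlgebra K :=
  LieAlgebra block_br_linearl block_br_linearr block_brxx block_jacobi.

End Block.

Import mpoly.

Section Omega.
Context (K : numFieldType) (q : K) (lambda : K * K) (alpha : K).
Local Notation Z2 := (int * int)%type.
Local Notation P2 := {mpoly K[2]}.
Implicit Types (m n : Z2) (f : P2).

(* 'X_0 and 'X_1 are the two variables of {mpoly K[2]}, indexed by 'I_2. *)
Definition del1 : P2 := 'X_0.
Definition del2 : P2 := 'X_1.

(* shift m f is f(del1 - m.1, del2 - m.2). *)
Definition shift m f : P2 :=
  f \mPo [tuple del1 - (m.1%:~R)%:MP; del2 - (m.2%:~R)%:MP].

(* The action of L_m; the exponents in _ ^ m.1 and _ ^ m.2 are in int. *)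
Definition Omega_basis m f : P2 :=
  (lambda.1 ^ m.1 * lambda.2 ^ m.2) *:
    ((del1 * (q + m.2%:~R)%:MP - (m.1%:~R)%:MP * ((q * alpha)%:MP + del2))
     * shift m f).

Definition Omega_act (x : block q) f : P2 := malg_ext (Omega_basis^~ f) x.

Lemma Omega_actU m f : Omega_act << m >> f = Omega_basis m f.
Proof. exact: malg_extU. Qed.

Fact Omega_act_linearl f : linear (Omega_act^~ f).
Proof. exact: malg_ext_linear. Qed.

Lemma Omega_basis_linear m : linear (Omega_basis m).
Proof.
move=> a u v; rewrite /Omega_basis /shift linearP /= mulrDr scalerDr.
by rewrite -scalerAr !scalerA mulrC.
Qed.

Fact Omega_act_linearr x : linear (Omega_act x).
Proof.
move=> a u v; rewrite /Omega_act -malg_ext_scale -malg_ext_add.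
by apply: malg_ext_eq => m; rewrite Omega_basis_linear.
Qed.

Lemma shift_del1 m : shift m del1 = del1 - (m.1%:~R)%:MP.
Proof. by rewrite /shift comp_mpolyXU. Qed.

Lemma shift_del2 m : shift m del2 = del2 - (m.2%:~R)%:MP.
Proof. by rewrite /shift comp_mpolyXU. Qed.

Lemma shiftC m (a : K) : shift m a%:MP = a%:MP.
Proof. exact: comp_mpolyC. Qed.

Lemma shiftD m : {morph shift m : f h / f + h}.
Proof. by move=> f h; rewrite /shift raddfD. Qed.

Lemma shiftN m : {morph shift m : f / - f}.
Proof. by move=> f; rewrite /shift raddfN. Qed.

Lemma shiftZ m a : {morph shift m : f / a *: f}.
Proof. by move=> f; rewrite /shift linearZ. Qed.

Lemma shiftM m : {morph shift m : f h / f * h}.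
Proof. by move=> f h; rewrite /shift rmorphM. Qed.

Lemma shift_shift m n f : shift m (shift n f) = shift (m + n) f.
Proof.
elim/mpolyind: f => [|a k f _ _ IH]; first by rewrite /shift !raddf0.
rewrite (shiftD n) (shiftD m) (shiftD (m + n)) IH; congr (_ + _).
rewrite (shiftZ n) (shiftZ m) (shiftZ (m + n)); congr (a *: _).
rewrite mpolyXE_id !big_ord_recl big_ord0 mulr1.
have -> : 'X_ord0 = del1 by [].
have -> : 'X_(lift ord0 ord0) = del2 by congr ('X_ _); apply: val_inj.
have sX l h e : shift l (h ^+ e) = shift l h ^+ e by rewrite /shift rmorphXn.
rewrite !(shiftM, sX, shift_del1, shift_del2, shiftD, shiftN, shiftC) /= !intrD.
by rewrite !mpolyCD !opprD !addrA.
Qed.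

Hypothesis lambda_neq0 : lambda.1 * lambda.2 != 0.

Lemma Omega_basis_br m n f :
  block_coef q m n *: Omega_basis (m + n) f =
  Omega_basis m (Omega_basis n f) - Omega_basis n (Omega_basis m f).
Proof.
have := lambda_neq0; rewrite mulf_eq0 negb_or => /andP[l1 l2].
rewrite /Omega_basis !(shiftZ, shiftM) !shift_shift (addrC n m).
rewrite !(shiftD, shiftN, shiftM, shiftC, shift_del1, shift_del2) /=.
rewrite !expfzDr // /block_coef !intrD.
rewrite -!mul_mpolyC !(mpolyCM, mpolyCD, mpolyCN).
by ring.
Qed.

Fact Omega_act_br (x y : block q) f :
  Omega_act (lie_br x y) f =
  Omega_act x (Omega_act y f) - Omega_act y (Omega_act x f).
Proof.
have lact (z : block q) (g : block q -> P2) : linear g ->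
    linear (fun u => Omega_act z (g u)).
  by move=> lg a u v; rewrite lg Omega_act_linearr.
pose br : block q -> block q -> block q := @lie_br _ (block q).
apply: (@eq_malg_linear K Z2 P2 (fun x => Omega_act (br x y) f)
  (fun x => Omega_act x (Omega_act y f) - Omega_act y (Omega_act x f))) => [||m].
- by move=> a u v; rewrite /br lie_br_linearl Omega_act_linearl.
- apply: linear_predD; first exact: Omega_act_linearl.
  by apply: linear_predN; apply: lact; apply: Omega_act_linearl.
apply: (@eq_malg_linear K Z2 P2 (fun y => Omega_act (br << m >> y) f)
  (fun y => Omega_act << m >> (Omega_act y f)
            - Omega_act y (Omega_act << m >> f))) => [||n].
- by move=> a u v; rewrite /br lie_br_linearr Omega_act_linearl.
- apply: linear_predD; last exact/linear_predN/Omega_act_linearl.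
  by apply: lact; apply: Omega_act_linearl.
rewrite [br _ _]block_brE.
have -> a u : Omega_act (a *: u) f = a *: Omega_act u f.
  exact: linear_predZ (Omega_act_linearl f) a u.
by rewrite !Omega_actU; exact: Omega_basis_br.
Qed.

Definition Omega : lieModule (block q) :=
  LieModule Omega_act_linearl Omega_act_linearr Omega_act_br.

Definition Omega'_set : set Omega :=
  [set f : P2 | exists g h : P2, f = del1 * g + ((q * alpha)%:MP + del2) * h].

Fact Omega'_0 : Omega'_set 0.
Proof. by exists 0, 0; rewrite !mulr0 addr0. Qed.

Fact Omega'_linear (a : K) (u v : Omega) :
  Omega'_set u -> Omega'_set v -> Omega'_set (a *: u + v).
Proof.
move=> [g [h ->]] [g' [h' ->]]; exists (a *: g + g'), (a *: h + h').
by rewrite !mulrDr -!scalerAr scalerDr addrACA.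
Qed.

Fact Omega'_act (x : block q) (v : Omega) :
  Omega'_set v -> Omega'_set (lie_act x v).
Proof.
move=> _; rewrite /= /Omega_act /malg_ext.
elim: (enum_fset _) => [|m s IH]; first by rewrite big_nil; apply: Omega'_0.
rewrite big_cons; apply: Omega'_linear IH.
set c := lambda.1 ^ m.1 * lambda.2 ^ m.2.
exists (c *: ((q + m.2%:~R)%:MP * shift m v)),
       (c *: (- (m.1%:~R)%:MP * shift m v)).
rewrite /Omega_basis -/c -!scalerAr -scalerDr; congr (c *: _).
by ring.
Qed.

Definition Omega' : lieSubmodule Omega :=
  LieSubmodule Omega'_0 Omega'_linear Omega'_act.

End Omega.

(* Main.v *)
From HB Require Import structures.
Require Import Defs.
From mathcomp Require Import all_boot all_order all_algebra.
From mathcomp Require Import boolp classical_sets reals complex.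
From mathcomp.multinomials Require Import monalg.
From mathcomp.multinomials Require mpoly.
From mathcomp Require Import ring.

Set Implicit Arguments.
Unset Strict Implicit.
Unset Printing Implicit Defensive.

Import GRing.Theory Num.Theory.
Import mpoly.
Local Open Scope ring_scope.

(** Write x for del1 and y for q alpha + del2.  Up to a nonzero scalar, L_m
    acts by f |-> (x (q + m.2) - m.1 y) f(x - m.1, y - m.2), and Omega' is the
    ideal (x, y), of codimension one.  The theorem follows once every nonzero
    submodule N is known to contain Omega' ([Omega'_subset]): a submodule that
    contains Omega' and a further element contains a nonzero constant, hence
    is everything; and a submodule of Omega' is also a submodule of Omega.

    Let f be a nonzero element of N; finite differences bring it down to x and
    y, and then x and y generate the ideal.

    - L_0 acts as q x, so N is stable under x.  Since q + t <> 0 for some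
      integer t <> 0, N also contains x f(x, y - t), by L_(0,t), and so
      x (f(x, y - t) - f), which is nonzero of smaller degree in y as long as
      f involves y.  Hence N contains some nonzero p(x), free of y
      ([exists_mem_poly1]).

    - On p(x) the shift in y is invisible, so comparing L_(k,1) with L_(k,0)
      gives x p(x - k) in N, and then L_(k,0) gives y p(x - k) in N for
      k <> 0.  The set of those h with x h(x - k) and y h(x - k) in N for all
      k > 0 is a subspace stable under h |-> h(x - 1) - h, which lowers the
      degree without killing any nonconstant h; as it contains p, it contains
      a nonzero constant.  Therefore x and y lie in N ([mem_xy]).

    - By induction on n, N contains x g(x) y^n and y g(x) y^n for all g: apply
      L_(1,0) to y g(x + 1) y^n and remove the term q x y g(x) y^n
      ([mem_xy_monomial]). *)

(** * Finite differences of polynomials in characteristic zero *)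

Section FiniteDifference.
Context (R : idomainType) (charR0 : [pchar R] =i pred0).
Implicit Types (p : {poly R}) (t : R).

Lemma size_poly_translate p t : size (p \Po ('X - t%:P)) = size p.
Proof. by rewrite size_comp_poly2 ?size_XsubC. Qed.

Lemma size_poly_difference p t :
  p != 0 -> (size (p \Po ('X - t%:P) - p)%R < size p)%N.
Proof.
move=> p0; rewrite -[size p]prednK ?size_poly_gt0 // ltnS.
apply/leq_sizeP => j; rewrite leq_eqVlt => /orP[/eqP <-|lt].
  rewrite coefB -{1}(size_poly_translate p t) -!lead_coefE.
  rewrite lead_coef_comp ?size_XsubC //.
  by rewrite lead_coefXsubC expr1n mulr1 subrr.
have sz : (size p <= j)%N by rewrite -[size p]prednK ?size_poly_gt0.
by rewrite coefB !nth_default ?subr0 ?size_poly_translate.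
Qed.

(** If p(X - t) = p(X) then p takes the value p(0) at all the points - k t,
    which are pairwise distinct in characteristic zero, so p is constant. *)
Lemma poly_difference_neq0 p t :
  t != 0 -> (1 < size p)%N -> p \Po ('X - t%:P) - p != 0.
Proof.
move=> t0 sp; apply/negP => /eqP/subr0_eq pE.
have per k : p.[- (t *+ k)] = p.[0].
  elim: k => [|k <-]; first by rewrite mulr0n oppr0.
  by rewrite -{2}pE horner_comp !hornerE mulrSr opprD.
pose r := p - p.[0]%:P.
have r0 : r != 0.
  rewrite subr_eq0; apply/eqP => E; move: sp; rewrite E ltnNge.
  by rewrite size_polyC_leq1.
have := max_poly_roots (rs := [seq - (t *+ k) | k <- iota 0 (size r)]) r0.
rewrite size_map size_iota ltnn => H.
suff: false by []. apply: H.
  by apply/allP => _ /mapP[k _ ->]; rewrite rootE !hornerE per subrr.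
rewrite map_inj_in_uniq ?iota_uniq // => i j _ _ /oppr_inj E.
wlog le : i j E / (i <= j)%N => [W|].
  by case/orP: (leq_total i j) => le; [|symmetry]; apply: W.
move/eqP: E; rewrite eq_sym -subr_eq0 -mulrnBr // -mulr_natr.
rewrite mulf_eq0 (negPf t0) /= (pcharf0P R).1 // subn_eq0 => /(conj le)/andP.
by rewrite -eqn_leq => /eqP.
Qed.

End FiniteDifference.

(** * Subspaces stable under the Block algebra contain the ideal (x, y) *)

Section Generation.
Context (K : numFieldType) (q : K) (alpha : K).
Local Notation P2 := {mpoly K[2]}.
Local Notation x := (del1 K).
Local Notation y := ((q * alpha)%:MP + del2 K : P2).
Implicit Types (f g : P2) (p h : {poly K}) (P : {poly {poly K}}).

Local Notation poly1 := (horner_alg x).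

(** Polynomials in y with coefficients in K[x], which gives access to the degree
    in y.  The descents on the degree take place in {poly {poly K}}, so only
    the surjectivity of this map matters. *)
Definition poly2 P : P2 := (map_poly poly1 P).[y].

HB.instance Definition _ :=
  GRing.RMorphism.copy poly2 (horner_eval y \o map_poly poly1).

Lemma poly1C (c : K) : poly1 c%:P = c%:MP.
Proof. by rewrite horner_algC -mul_mpolyC mulr1. Qed.

Lemma poly2C p : poly2 p%:P = poly1 p.
Proof. by rewrite /poly2 map_polyC hornerC. Qed.

Lemma poly2X : poly2 'X = y.
Proof. by rewrite /poly2 map_polyX hornerX. Qed.

Lemma poly2_surj f : exists P, poly2 P = f.
Proof.
elim/mpolyind: f => [|c m f _ _ [P <-]]; first by exists 0; rewrite rmorph0.
(* The variable del2 is y - q alpha. *)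
exists ((c%:P * 'X ^+ m ord0)%:P
        * ('X - (q * alpha)%:P%:P) ^+ m (lift ord0 ord0) + P).
rewrite rmorphD rmorphM rmorphXn rmorphB /= !poly2C poly2X rmorphM rmorphXn /=.
rewrite horner_algX !poly1C -mul_mpolyC mpolyXE_id !big_ord_recl big_ord0 mulr1.
have -> : 'X_ord0 = x by [].
have -> : 'X_(lift ord0 ord0) = del2 K by congr ('X_ _); apply: val_inj.
by rewrite addrAC subrr add0r mulrA.
Qed.

Lemma shift_poly1 m p :
  shift m (poly1 p) = poly1 (p \Po ('X - (m.1%:~R)%:P)).
Proof.
elim/poly_ind: p => [|p c IH].
  by rewrite comp_poly0 !rmorph0 /shift raddf0.
rewrite comp_polyD comp_polyM comp_polyX comp_polyC !rmorphD !rmorphM /=.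
rewrite shiftD shiftM IH !rmorphB /= horner_algX !poly1C shift_del1.
by rewrite shiftC.
Qed.

Lemma shift_poly2 (t : int) P :
  shift (0, t) (poly2 P) = poly2 (P \Po ('X - (t%:~R)%:P)).
Proof.
elim/poly_ind: P => [|P p IH].
  by rewrite comp_poly0 !rmorph0 /shift raddf0.
rewrite comp_polyD comp_polyM comp_polyX comp_polyC !rmorphD !rmorphM /=.
rewrite shiftD shiftM IH !rmorphB /= poly2X !poly2C shift_poly1 /=.
rewrite subr0 comp_polyXr shiftD shiftC shift_del2 /=.
by rewrite -(rmorph_int (@polyC K)) /= poly1C addrA.
Qed.

(* S is a submodule of Omega, with the nonzero factor given by lambda left out
   of the action of L_m. *)
Variable S : P2 -> Prop.
Hypothesis q_neq0 : q != 0.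
Hypothesis S0 : S 0.
Hypothesis S_linear : forall (a : K) f g, S f -> S g -> S (a *: f + g).
Hypothesis S_act : forall (m : int * int) f, S f ->
  S ((x * (q + m.2%:~R)%:MP - (m.1%:~R)%:MP * y) * shift m f).

Lemma memZ a f : S f -> S (a *: f).
Proof. by move=> Sf; rewrite -[_ *: _]addr0; apply: S_linear. Qed.

Lemma memD f g : S f -> S g -> S (f + g).
Proof. by rewrite -{2}[f]scale1r; apply: S_linear. Qed.

Lemma memB f g : S f -> S g -> S (f - g).
Proof. by move=> Sf Sg; rewrite addrC -scaleN1r; apply: S_linear. Qed.

Lemma memZ_inv a f : a != 0 -> S (a *: f) -> S f.
Proof. by move=> a0 /(memZ a^-1); rewrite scalerA mulVf // scale1r. Qed.

Lemma shift00 f : shift (0, 0) f = f.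
Proof.
by have [P <-] := poly2_surj f; rewrite shift_poly2 mulr0z subr0 comp_polyXr.
Qed.

(** L_0 acts as multiplication by q x. *)
Lemma mem_x f : S f -> S (x * f).
Proof.
move=> /(@S_act (0, 0)) /=; rewrite shift00 addr0 !mulr0z !mpolyC0 mul0r subr0.
by rewrite mulrAC mulrC mul_mpolyC; apply: memZ_inv.
Qed.

(** L_(0,t) acts as (q + t) x f(x, y - t), and q + t vanishes for at most one
    of the values t = 1, 2. *)
Lemma mem_x_shift_y : exists2 t : int, t != 0 &
  forall f, S f -> S (x * shift (0, t) f).
Proof.
have [t t0 qt] : exists2 t : int, t != 0 & q + t%:~R != 0.
  have [q1|] := eqVneq (q + 1) 0; last by exists 1.
  exists 2; rewrite // [2%:~R](_ : _ = 1 + 1 :> K) // addrA q1 add0r.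
  exact: oner_neq0.
exists t => // f /(@S_act (0, t)) /=.
rewrite mulr0z mpolyC0 mul0r subr0 mulrAC mulrC mul_mpolyC.
exact: memZ_inv.
Qed.

(** A polynomial in x alone has the same image under the shifts by (k, 1) and
    (k, 0), so L_(k,1) - L_(k,0) only leaves the factor x. *)
Lemma mem_x_translate p (k : int) :
  S (poly1 p) -> S (x * poly1 (p \Po ('X - (k%:~R)%:P))).
Proof.
move=> Sp; have := memB (@S_act (k, 1) _ Sp) (@S_act (k, 0) _ Sp).
rewrite !shift_poly1 /= -mulrBl; congr S; congr (_ * _).
by rewrite addr0 mpolyCD; ring.
Qed.

(** L_(k,0) has the factor q x - k y, where the q x part is accounted for by
    [mem_x_translate]. *)
Lemma mem_y_translate p (k : int) : k != 0 ->
  S (poly1 p) -> S (y * poly1 (p \Po ('X - (k%:~R)%:P))).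
Proof.
move=> k0 Sp; apply: (@memZ_inv k%:~R); first by rewrite intr_eq0.
have := memB (memZ q (@mem_x_translate _ k Sp)) (@S_act (k, 0) _ Sp).
rewrite !shift_poly1 /= addr0; congr S.
by rewrite -!mul_mpolyC; ring.
Qed.

(** Descent on the degree in y, by P |-> x (P(x, y - t) - P). *)
Lemma exists_mem_poly1 P :
  P != 0 -> S (poly2 P) -> exists2 p, p != 0 & S (poly1 p).
Proof.
have [t t0 St] := mem_x_shift_y.
have tP0 : t%:~R != 0 :> {poly K}.
  by rewrite -(rmorph_int (@polyC K)) polyC_eq0 intr_eq0.
have ch0 : [pchar {poly K}] =i pred0.
  by move=> n; rewrite pchar_poly pchar_num.
move: {2}(size P) (leqnn (size P)) => n; elim: n P => [|n IH] P.
  by rewrite leqn0 size_poly_eq0 => /eqP->; rewrite eqxx.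
move=> sP P0 SP; have [sP1|sP1] := leqP (size P) 1.
  have PE := size1_polyC sP1; exists P`_0; last by rewrite -poly2C -PE.
  by apply: contra P0 => /eqP p0; rewrite PE p0.
set D := P \Po ('X - (t%:~R)%:P) - P.
have D0 : D != 0 by apply: poly_difference_neq0.
apply: (IH ('X%:P * D)).
- rewrite mul_polyC size_scale ?polyX_eq0 // -ltnS.
  exact: leq_trans (size_poly_difference _ _) sP.
- by rewrite mulf_neq0 // polyC_eq0 polyX_eq0.
rewrite rmorphM rmorphB /= poly2C horner_algX mulrBr -shift_poly2.
by apply: memB; [apply: St | apply: mem_x].
Qed.

(** Iterated differences of the translates of p reach a nonzero constant. *)
Lemma mem_xy p : p != 0 -> S (poly1 p) -> S x /\ S y.
Proof.
move=> p0 Sp.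
pose T (h : {poly K}) k := h \Po ('X - (k%:~R)%:P).
(* The value k = 0 is excluded for y; the range k > 0 is stable under
   k |-> k + 1, and this makes W stable under differences. *)
pose W h := forall k : int, 0 < k ->
  S (x * poly1 (T h k)) /\ S (y * poly1 (T h k)).
have WT h : W h -> W (h \Po ('X - 1%:P) - h).
  move=> Wh k k0; rewrite /T comp_polyB -comp_polyA comp_polyB comp_polyX.
  rewrite comp_polyC.
  have -> : 'X - (k%:~R)%:P - 1%:P = 'X - ((k + 1)%:~R)%:P :> {poly K}.
    by rewrite intrD polyCD opprD addrA.
  have [Sx1 Sy1] : S (x * poly1 (T h (k + 1))) /\ S (y * poly1 (T h (k + 1))).
    by apply: Wh; rewrite addr_gt0.
  have [Sx Sy] := Wh k k0.
  by rewrite rmorphB !mulrBr; split; apply: memB.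
have Wp : W p.
  move=> k k0; split; first exact: mem_x_translate.
  by apply: mem_y_translate => //; apply: contraTneq k0 => ->.
move: {2}(size p) (leqnn (size p)) => n.
elim: n p p0 Wp {Sp} => [|n IH] p.
  by move=> + _; rewrite leqn0 size_poly_eq0 => /negPf->.
move=> p0 Wp sp; have [sp1|sp1] := leqP (size p) 1.
  have [] := Wp 1 isT; have pE := size1_polyC sp1.
  have c0 : p`_0 != 0 by apply: contra p0 => /eqP c0; rewrite pE c0.
  rewrite /T pE comp_polyC poly1C ![_ * _%:MP]mulrC !mul_mpolyC.
  by split; apply: memZ_inv c0 _.
apply: (IH (p \Po ('X - 1%:P) - p)).
- by apply: poly_difference_neq0; rewrite ?oner_eq0 //; apply: pchar_num.
- exact: WT.
by rewrite -ltnS (leq_trans (size_poly_difference _ _)).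
Qed.

Lemma mem_x_poly1 p : S x -> S (x * poly1 p).
Proof.
move=> Sx; elim/poly_ind: p => [|p c IH]; first by rewrite rmorph0 mulr0.
rewrite rmorphD rmorphM /= horner_algX poly1C mulrDr (mulrC _ x).
by apply: memD; [apply: mem_x | rewrite mulrC mul_mpolyC; apply: memZ].
Qed.

(** [mem_y_translate] with k = 1, applied to multiples of x, yields y g(x) for
    all g vanishing at 1; every p is such a g plus a constant. *)
Lemma mem_y_poly1 p : S x -> S y -> S (y * poly1 p).
Proof.
move=> Sx Sy; pose c := p.[1].
have /factor_theorem[h hE] : root (p - c%:P) 1 by rewrite rootE !hornerE subrr.
have -> : p = ('X * (h \Po ('X + 1%:P))) \Po ('X - (1%:~R)%:P) + c%:P.
  rewrite comp_polyM comp_polyX -comp_polyA comp_polyD comp_polyX comp_polyC.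
  by rewrite subrK comp_polyXr mulrC -hE subrK.
rewrite rmorphD mulrDr /= poly1C.
apply: memD; last by rewrite mulrC mul_mpolyC; apply: memZ.
apply: mem_y_translate => //.
by rewrite rmorphM /= horner_algX; apply: mem_x_poly1.
Qed.

(** The x part at n + 1 is the y part at n for x p.  For the y part, L_(1,0)
    maps y p(x + 1) y^n to (q x - y) y p(x) y^n. *)
Lemma mem_xy_monomial p n : S x -> S y ->
  S (x * (poly1 p * y ^+ n)) /\ S (y * (poly1 p * y ^+ n)).
Proof.
move=> Sx Sy; elim: n p => [|n IH] p.
  by rewrite mulr1; split; [apply: mem_x_poly1 | apply: mem_y_poly1].
have Sxp : S (x * (poly1 p * y ^+ n.+1)).
  have [_] := IH ('X * p); rewrite (rmorphM poly1) /= horner_algX exprS.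
  by congr S; ring.
split=> //.
have [_ /(@S_act (1, 0))] := IH (p \Po ('X + 1%:P)).
have sy : shift (1, 0) y = y by rewrite shiftD shiftC shift_del2 /= subr0.
have sX f e : shift (1, 0) (f ^+ e) = shift (1, 0) f ^+ e.
  by rewrite /shift rmorphXn.
rewrite !shiftM sX sy shift_poly1 /= -comp_polyA comp_polyD comp_polyX.
rewrite comp_polyC subrK comp_polyXr addr0 => /(memB (memZ q Sxp)).
by congr S; rewrite -!mul_mpolyC mpolyC1 exprS; ring.
Qed.

Lemma mem_ideal f g (h : P2) : f != 0 -> S f -> S (x * g + y * h).
Proof.
move=> + Sf; have [P fE] := poly2_surj f; rewrite -fE in Sf * => f0.
have P0 : P != 0 by apply: contra f0 => /eqP->; rewrite rmorph0.
have [p p0 Sp] := exists_mem_poly1 P0 Sf.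
have [Sx Sy] := mem_xy p0 Sp.
have Smul e : S (x * e) /\ S (y * e).
  have [Q <-] := poly2_surj e.
  rewrite -[Q]coefK poly_def rmorph_sum !mulr_sumr.
  suff H i : S (x * poly2 (Q`_i *: 'X^i)) /\ S (y * poly2 (Q`_i *: 'X^i)).
    by split; apply: (big_ind S) => // [|i _];
      [exact: memD | case: (H i) | exact: memD | case: (H i)].
  rewrite -mul_polyC rmorphM rmorphXn /= poly2C poly2X.
  exact: mem_xy_monomial.
by apply: memD; [case: (Smul g) | case: (Smul h)].
Qed.

End Generation.

(** * Submodules of Omega *)

Section OmegaSubmodules.
Context (K : numFieldType) (q alpha : K) (lambda : K * K).
Context (hlambda : lambda.1 * lambda.2 != 0) (q_neq0 : q != 0).
Local Notation P2 := {mpoly K[2]}.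
Local Notation Om := (Omega q alpha hlambda).
Local Notation Om' := (Omega' q alpha hlambda).
Local Open Scope classical_set_scope.

(** The factor lambda ^ m in the action of L_m is nonzero, so that N is also
    stable under the action without it, to which [mem_ideal] applies. *)
Lemma Omega'_subset (N : lieSubmodule Om) :
  lsub_set N <> [set 0] -> lsub_set Om' `<=` lsub_set N.
Proof.
move=> N0 _ [g [h ->]].
have [f Nf f0] : exists2 f : P2, lsub_set N f & f != 0.
  apply: contrapT => H; apply: N0; rewrite eqEsubset.
  split => [f Nf|_ ->]; last exact: lsub0.
  by apply: contrapT => f0; apply: H; exists f => //; apply/eqP.
have := @mem_ideal K q alpha (lsub_set N : P2 -> Prop) q_neq0.
apply; [exact: lsub0|exact: (@lsub_linear _ _ _ N)| |exact: f0|exact: Nf].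
move=> m v /(@lsub_act _ _ _ N << m >>); rewrite /= Omega_actU /Omega_basis.
apply: memZ_inv.
- exact: lsub0.
- exact: (@lsub_linear _ _ _ N).
by move: hlambda; rewrite !mulf_eq0 !negb_or => /andP[? ?]; rewrite !expfz_neq0.
Qed.

(** Modulo x and y, a polynomial in x and y is its constant coefficient. *)
Lemma Omega'_decomp (f : P2) : exists c : K, lsub_set Om' (f - c%:MP).
Proof.
have [P <-] := poly2_surj q alpha f.
elim/poly_ind: P => [|P p _].
  by exists 0; rewrite rmorph0 subr0; exact: (@lsub0 _ _ _ Om').
elim/poly_ind: p => [|p c _].
  exists 0; exists 0, (poly2 q alpha P).
  by rewrite addr0 subr0 mulr0 add0r rmorphM /= poly2X mulrC.
exists c, (horner_alg (del1 K) p), (poly2 q alpha P).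
by rewrite !rmorphD !rmorphM /= poly2X !poly2C horner_algX poly1C; ring.
Qed.

(** Evaluate at the common zero (0, - q alpha) of x and y. *)
Lemma const_Omega' (c : K) : lsub_set Om' c%:MP -> c = 0.
Proof.
pose v (i : 'I_2) := if i == ord0 then 0 else - (q * alpha).
move=> [g [h /(congr1 (meval v))]].
rewrite mevalC mevalD !mevalM mevalD mevalC !mevalXU /= => ->.
by rewrite mul0r addrN mul0r addr0.
Qed.

Lemma del1_neq0 : del1 K != 0.
Proof.
apply/eqP => /(congr1 (meval (fun=> 1))) /eqP.
by rewrite mevalXU meval0 oner_eq0.
Qed.

Lemma del1_Omega' : lsub_set Om' (del1 K).
Proof. by exists 1, 0; rewrite mulr1 mulr0 addr0. Qed.

Lemma Omega'_neq0 : lsub_set Om' <> [set 0].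
Proof.
by move=> E; have := del1_Omega'; rewrite E => /eqP; apply/negP/del1_neq0.
Qed.

Lemma Omega'_neqT : lsub_set Om' <> setT.
Proof.
move=> E; have /const_Omega'/eqP : lsub_set Om' (1 : K)%:MP by rewrite E.
by rewrite oner_eq0.
Qed.

Lemma Omega'_unique (N : lieSubmodule Om) :
  nonzero_proper N -> lsub_set N = lsub_set Om'.
Proof.
move=> [N0 NT]; have sub := Omega'_subset N0.
rewrite eqEsubset; split => // f Nf; have [c fc] := Omega'_decomp f.
have Nlin (a : K) (u v : P2) :
    lsub_set N u -> lsub_set N v -> lsub_set N (a *: u + v : P2).
  exact: lsub_linear.
have Nc : lsub_set N (c%:MP : P2).
  by have := Nlin (-1) _ _ (sub _ fc) Nf; rewrite scaleN1r opprB subrK.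
have [c0|c0] := eqVneq c 0; first by rewrite c0 mpolyC0 subr0 in fc.
case: NT; rewrite eqEsubset; split => // g _; have [d gd] := Omega'_decomp g.
have := Nlin (d / c) _ _ Nc (sub _ gd).
by rewrite -mul_mpolyC -mpolyCM divfK // addrC subrK.
Qed.

Section Image.
(* A submodule of the module Omega' is carried over to Omega, where
   [Omega'_subset] applies. *)
Variable N : lieSubmodule (submodule_lieModule Om').

Definition image_set : set Om := [set lsub_val v | v in lsub_set N].

Fact image0 : image_set 0.
Proof. by exists 0 => //; exact: lsub0. Qed.

Fact image_linear (a : K) u v :
  image_set u -> image_set v -> image_set (a *: u + v).
Proof.
move=> [u' Nu <-] [v' Nv <-].
by exists (a *: u' + v') => //; exact: lsub_linear.
Qed.

Fact image_act z v : image_set v -> image_set (lie_act z v).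
Proof.
by move=> [v' Nv <-]; exists (lie_act z v') => //; exact: lsub_act.
Qed.

Definition image_submodule : lieSubmodule Om :=
  LieSubmodule image0 image_linear image_act.

End Image.

Lemma Omega'_simple : simple_lieModule (submodule_lieModule Om').
Proof.
split=> [E|N].
  have d1 : del1 K \in lsub_pred Om' by apply/asboolP/del1_Omega'.
  have : [set: submodule_lieModule Om'] (LsubElt d1) by [].
  by rewrite E => /(congr1 val)/eqP; apply/negP/del1_neq0.
have [->|N0] := pselect (lsub_set N = [set 0]); [by left|right].
rewrite eqEsubset; split => // v _.
have /Omega'_subset sub : lsub_set (image_submodule N) <> [set 0].
  move=> E; apply: N0; rewrite eqEsubset.
  split => [u Nu|_ ->]; last exact: lsub0.
  have : lsub_set (image_submodule N) (val u) by exists u.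
  by rewrite E => u0; apply: val_inj.
have [|u Nu uv] := sub (val v); first by case: v => w /= /asboolP.
by rewrite -(val_inj uv).
Qed.

End OmegaSubmodules.

Theorem theorem2p3 (R : realType) (q : R[i]) (hq : q != 0)
    (lambda : R[i] * R[i]) (hlambda : lambda.1 * lambda.2 != 0)
    (alpha : R[i]) :
  (nonzero_proper (Omega' q alpha hlambda) /\
   forall N : lieSubmodule (Omega q alpha hlambda),
     nonzero_proper N ->
     lsub_set N = lsub_set (Omega' q alpha hlambda)) /\
  simple_lieModule (submodule_lieModule (Omega' q alpha hlambda)).
Proof.
split; last exact: Omega'_simple.
split; first by split; [exact: Omega'_neq0 | exact: Omega'_neqT].
by move=> N; exact: Omega'_unique.
Qed.
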